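(* Let $m,n,d\in\mathbb{N}$ and let $\mathcal{H}_{\mathrm{MF}}:\mathbb{R}^{d\times m}\times\mathbb{R}^{d\times n}\to\mathbb{R}^{m\times n}$, $\mathcal{H}_{\mathrm{MF}}(X,Y):=X^{\mathrm T}Y$. Then $\mathcal{H}_{\mathrm{MF}}$ is locally surjective at the origin if and only if $d\ge\min\{m,n\}$.
   Context: $\mathbb{N}$ is the set of positive integers. Spaces of matrices and their products carry the Frobenius norm, and $\mathbb{B}$ denotes the closed unit ball of the relevant space. A mapping $\mathcal{F}$ between Euclidean spaces is locally surjective at $x$ if for any $t>0$ there exists $r>0$ such that $\mathcal{F}(x)+r\mathbb{B}\subseteq\mathcal{F}(x+t\mathbb{B})$. *)

(* Defs.v *)
From mathcomp Require Export all_boot all_order all_algebra.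
From mathcomp Require Export classical_sets reals.

Set Implicit Arguments.
Unset Strict Implicit.
Unset Printing Implicit Defensive.

Import Order.TTheory GRing.Theory Num.Theory.

Local Open Scope classical_set_scope.
Local Open Scope ring_scope.

(* The norms are explicit functions: the norm that MathComp-Analysis attaches
   to matrices and to products is the max-norm, not the Frobenius norm. *)
Definition frobenius (R : realType) (p q : nat) (A : 'M[R]_(p, q)) : R :=
  Num.sqrt (\sum_(i < p) \sum_(j < q) A i j ^+ 2).

Definition frobenius_pair (R : realType) (p q k l : nat)
    (Z : 'M[R]_(p, q) * 'M[R]_(k, l)) : R :=
  Num.sqrt (frobenius Z.1 ^+ 2 + frobenius Z.2 ^+ 2).

Definition closed_unit_ball (R : realType) (V : lmodType R) (N : V -> R) :
  set V := [set v | N v <= 1].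

Definition locally_surjective_at (R : realType) (U V : lmodType R)
    (NU : U -> R) (NV : V -> R) (F : U -> V) (x : U) : Prop :=
  forall t : R, 0 < t -> exists2 r : R, 0 < r &
    [set F x + r *: b | b in closed_unit_ball NV] `<=`
    F @` [set x + t *: b | b in closed_unit_ball NU].

Definition H_MF (R : realType) (m n d : nat)
    (Z : 'M[R]_(d, m) * 'M[R]_(d, n)) : 'M[R]_(m, n) :=
  Z.1^T *m Z.2.

(* Main.v *)
Require Import Defs.
From mathcomp Require Import all_boot all_order all_algebra.
From mathcomp Require Import classical_sets reals.
From mathcomp Require Import lra.

Import Order.TTheory GRing.Theory Num.Theory.

(** If [d < min m n], the image of [H_MF] consists of matrices of rank at most
    [d], whereas every neighbourhood of [0] contains a multiple of the full-rank
    matrix [pid_mx (minn m n)]. Conversely, if [k := m <= d], the partial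
    identity [P := pid_mx k] has orthonormal columns, so for [c := 1 / (k + 1)]
    the pair [(c P, c P A)] is sent to [c ^ 2 A] and its squared norm is
    [c ^ 2 (k + |A| ^ 2) <= c]; as [H_MF] is homogeneous of degree 2, this
    rescales to all balls. The case [n <= d] follows by transposition. *)

Local Open Scope ring_scope.

(** The trace form turns norm computations into matrix algebra, where orthonormal columns and
    cyclicity of the trace apply. *)
Lemma frobenius_sqr (R : realType) (p q : nat) (A : 'M[R]_(p, q)) :
  frobenius A ^+ 2 = \tr (A^T *m A).
Proof.
rewrite sqr_sqrtr; last by do 2!apply: sumr_ge0 => ? _; exact: sqr_ge0.
rewrite exchange_big; apply: eq_bigr => j _; rewrite mxE.
by apply: eq_bigr => i _; rewrite mxE expr2.
Qed.

Lemma frobenius_ge0 (R : realType) (p q : nat) (A : 'M[R]_(p, q)) :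
  0 <= frobenius A.
Proof. exact: sqrtr_ge0. Qed.

Lemma frobenius_tr (R : realType) (p q : nat) (A : 'M[R]_(p, q)) :
  frobenius A^T = frobenius A.
Proof.
apply/eqP; rewrite -(eqrXn2 (n := 2)) ?frobenius_ge0 // !frobenius_sqr.
by rewrite trmxK mxtrace_mulC.
Qed.

Lemma mulmx_trZ (R : realType) (m n d : nat) (c : R)
    (X : 'M[R]_(d, m)) (Y : 'M[R]_(d, n)) :
  (c *: X)^T *m (c *: Y) = c ^+ 2 *: (X^T *m Y).
Proof.
by rewrite -scalemxAr [(c *: X)^T]linearZ -scalemxAl scalerA.
Qed.

Lemma frobeniusZ_sqr (R : realType) (p q : nat) (c : R) (A : 'M[R]_(p, q)) :
  frobenius (c *: A) ^+ 2 = c ^+ 2 * frobenius A ^+ 2.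
Proof.
by rewrite !frobenius_sqr mulmx_trZ mxtraceZ.
Qed.

Lemma pid_mx_orthonormal (R : realType) (d k : nat) : (k <= d)%N ->
  (pid_mx k : 'M[R]_(d, k))^T *m pid_mx k = 1%:M.
Proof. by move=> kd; rewrite tr_pid_mx pid_mx_id // pid_mx_1. Qed.

Lemma unit_ball_factor (R : realType) (m n d : nat) : (m <= d)%N ->
  exists2 r : R, 0 < r & forall A : 'M[R]_(m, n), frobenius A <= 1 ->
    exists2 Z : 'M[R]_(d, m) * 'M[R]_(d, n),
      frobenius_pair Z <= 1 & H_MF Z = r *: A.
Proof.
move=> md; pose P : 'M[R]_(d, m) := pid_mx m.
have PP : P^T *m P = 1%:M by exact: pid_mx_orthonormal.
pose c : R := m.+1%:R^-1.
exists (c ^+ 2) => [|A A1]; first by rewrite exprn_gt0 // invr_gt0 ltr0n.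
exists (c *: P, c *: (P *m A)); last first.
  by rewrite /H_MF /= mulmx_trZ mulmxA PP mul1mx.
rewrite /frobenius_pair /= !frobeniusZ_sqr !frobenius_sqr trmx_mul.
(* Orthonormality enters twice: [P^T *m P] has trace [m], and [P *m A] has the same norm as [A]. *)
rewrite !mulmxA -(mulmxA A^T) PP mulmx1 mxtrace1 -frobenius_sqr.
rewrite -[leRHS]sqrtr1 ler_sqrt ?ler01 // -mulrDr.
have A2 : frobenius A ^+ 2 <= 1 by rewrite exprn_ile1 // frobenius_ge0.
apply: (@le_trans _ _ (c ^+ 2 * m.+1%:R)).
  by rewrite ler_wpM2l ?sqr_ge0 // -natr1 lerD2l.
by rewrite /c expr2 mulfVK ?pnatr_eq0 // invf_le1 ?ler1n ?ltr0n.
Qed.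

Lemma unit_ball_factor_tr (R : realType) (m n d : nat) : (n <= d)%N ->
  exists2 r : R, 0 < r & forall A : 'M[R]_(m, n), frobenius A <= 1 ->
    exists2 Z : 'M[R]_(d, m) * 'M[R]_(d, n),
      frobenius_pair Z <= 1 & H_MF Z = r *: A.
Proof.
move=> /(unit_ball_factor R n m)[r r0 rP]; exists r => // A.
(* A factorization [X^T *m Y] of [r *: A^T] transposes to [Y^T *m X = r *: A], hence the swapped
   pair. *)
rewrite -frobenius_tr => /rP[[X Y] XY1 XYE]; exists (Y, X).
  by rewrite /frobenius_pair addrC.
by apply: trmx_inj; rewrite linearZ /= -XYE /H_MF /= trmx_mul trmxK.
Qed.

Lemma H_MF0 (R : realType) (m n d : nat) :
  H_MF (0 : 'M[R]_(d, m) * 'M[R]_(d, n)) = 0.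
Proof. by rewrite /H_MF mulmx0. Qed.

Lemma H_MFZ (R : realType) (m n d : nat) (t : R)
    (Z : 'M[R]_(d, m) * 'M[R]_(d, n)) :
  H_MF (t *: Z) = t ^+ 2 *: H_MF Z.
Proof. by rewrite /H_MF /= mulmx_trZ. Qed.

Lemma rank_H_MF (R : realType) (m n d : nat)
    (Z : 'M[R]_(d, m) * 'M[R]_(d, n)) :
  (\rank (H_MF Z) <= d)%N.
Proof. exact: leq_trans (mxrankM_maxr _ _) (rank_leq_row _). Qed.

Lemma frobenius_scale_le1 (R : realType) (p q : nat) (A : 'M[R]_(p, q)) :
  exists2 c : R, 0 < c & frobenius (c *: A) <= 1.
Proof.
have A0 := frobenius_ge0 R p q A; have A1 : 0 < 1 + frobenius A by lra.
(* The added 1 keeps the divisor positive even when [A] is zero. *)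
exists (1 + frobenius A)^-1; first by rewrite invr_gt0.
rewrite -(ler_pXn2r (n := 2)) ?nnegrE ?frobenius_ge0 ?ler01 //.
rewrite frobeniusZ_sqr -exprMn expr1n exprn_ile1 //.
  by rewrite mulr_ge0 // invr_ge0 ltW.
by rewrite mulrC ler_pdivrMr //; lra.
Qed.

Theorem corollary3p11 (R : realType) (m n d : nat)
    (hm : (0 < m)%N) (hn : (0 < n)%N) (hd : (0 < d)%N) :
  locally_surjective_at (@frobenius_pair R d m d n) (@frobenius R m n)
    (@H_MF R m n d) (0 : 'M[R]_(d, m) * 'M[R]_(d, n))
  <-> (minn m n <= d)%N.
Proof.
(* Any [t] would do here: the rank bound holds on the whole image, so the ball containing [Z] is
   forgotten. *)
split=> [/(_ 1 ltr01)[r r0 rP]|mnd t t0].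
  have [c c0 c1] := frobenius_scale_le1 R m n (pid_mx (minn m n)).
  have [|Z _ ZE] := rP (r *: (c *: pid_mx (minn m n))).
    by exists (c *: pid_mx (minn m n)) => //; rewrite H_MF0 add0r.
  have := rank_H_MF R m n d Z; rewrite ZE !mxrank_scale_nz ?gt_eqF //.
  by rewrite rank_pid_mx ?geq_minl ?geq_minr.
have [r r0 rP] : exists2 r : R, 0 < r &
    forall A : 'M[R]_(m, n), frobenius A <= 1 ->
    exists2 Z : 'M[R]_(d, m) * 'M[R]_(d, n),
      frobenius_pair Z <= 1 & H_MF Z = r *: A.
  by move: mnd; rewrite geq_min => /orP[/unit_ball_factor|/unit_ball_factor_tr].
(* Scaling a preimage by [t] scales its image by [t ^+ 2]. *)
exists (t ^+ 2 * r); first by rewrite mulr_gt0 ?exprn_gt0.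
move=> _ [A /rP[Z Z1 ZE] <-]; exists (t *: Z).
  by exists Z; rewrite ?add0r.
by rewrite H_MFZ ZE H_MF0 add0r scalerA.
Qed.
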